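(* Let $\mathfrak R$ be an associative unital algebra over $\mathbb C$ and let $L(u)\in\mathfrak R((u^{-1}))\otimes\mathrm{Hom}(\mathbb C^m,\mathbb C^n)$. The matrix $L(u)$ is an $(\widehat A_n,\widehat A_m)$-Manin operator if and only if it satisfies the $RLL$-relation $$R_n(u_1-u_2)L^{(1)}(u_1)L^{(2)}(u_2)=L^{(2)}(u_2)L^{(1)}(u_1)R_m(u_1-u_2).$$
   Context: $\mathfrak R((u^{-1}))$ is the algebra of formal series $\sum_{k=-\infty}^{N}r_ku^k$, $N\in\mathbb Z$, $r_k\in\mathfrak R$. Let $P_n\in\mathrm{End}(\mathbb C^n\otimes\mathbb C^n)$, $P_n(v\otimes w)=w\otimes v$, and $R_n(u)=u-P_n$ (rational $R$-matrix). Writing $L(u)$ with entries $L^i_j(u)$, the operators $L^{(1)}(u_1)L^{(2)}(u_2)$ and $L^{(2)}(u_2)L^{(1)}(u_1)$ have entries (row index $(i,j)$, column index $(k,l)$) $L^i_k(u_1)L^j_l(u_2)$ and $L^j_l(u_2)L^i_k(u_1)$ respectively. Let $P_{u_1,u_2}$ be the operator permuting the variables: $(P_{u_1,u_2}f)(u_1,u_2)=f(u_2,u_1)$. The operator $$\widehat A_n=\frac{1-P_{u_1,u_2}P_n}{2}+\frac1{2(u_1-u_2)}(1-P_{u_1,u_2})$$ is an idempotent on $\mathbb C^n[u_1,u_1^{-1}]\otimes\mathbb C^n[u_2,u_2^{-1}]=\mathbb C^n\otimes\mathbb C^n[u_1^{\pm1},u_2^{\pm1}]$ (here $\frac{1}{u_1-u_2}(p(u_1,u_2)-p(u_2,u_1))$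 is the Laurent polynomial obtained by exact division). It extends continuously to the completion $\mathbb C^n\otimes\mathbb C^n((u_1^{-1},u_2^{-1}))$ consisting of formal series in $u_1^{\pm1},u_2^{\pm1}$ whose exponents in each variable are bounded above, and likewise with coefficients in $\mathfrak R$. An operator $M\colon\mathbb C^m[u,u^{-1}]\to\mathfrak R((u^{-1}))\otimes\mathbb C^n$ (an operator with entries in $\mathfrak R$) is called an $(\widehat A_n,\widehat A_m)$-Manin operator if $\widehat A_nM^{(1)}M^{(2)}(1-\widehat A_m)=0$, where $M^{(1)}$, $M^{(2)}$ act as $M$ in the first and second tensor factors of $\mathbb C^m[u_1,u_1^{-1}]\otimes\mathbb C^m[u_2,u_2^{-1}]$. The matrix $L(u)$ is regarded as the operator of multiplication by $L(u)$, so that $M^{(1)}M^{(2)}$ is multiplication by $L^{(1)}(u_1)L^{(2)}(u_2)$. *)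

(* Defs.v *)
From HB Require Import structures.
From mathcomp Require Import all_boot all_order all_algebra finmap.
From mathcomp Require Import monalg.
From mathcomp Require Import boolp classical_sets functions cardinality fsbigop.
From mathcomp Require Import zify.

Set Implicit Arguments.
Unset Strict Implicit.
Unset Printing Implicit Defensive.

Import Order.TTheory GRing.Theory Num.Theory.
Local Open Scope ring_scope.

(* {malg F[K]} is the free F-module with basis K; the basis vector k is << k >>.
   [mono n] is the basis e_i u^a of C^n[u,u^-1] and [mono2 n] is the basis
   e_i u1^a (x) e_j u2^b of C^n[u1,u1^-1] (x) C^n[u2,u2^-1].  They are records
   with opaque choice structures because unification modulo the structure of
   'I_n * int inside {malg _[_]} is prohibitively slow. *)

Record mono n := Mono { mi : 'I_n; md : int }.
HB.instance Definition _ n := gen_eqMixin (mono n).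
HB.instance Definition _ n := gen_choiceMixin (mono n).

Record mono2 n := Mono2 { mi1 : 'I_n; md1 : int; mi2 : 'I_n; md2 : int }.
HB.instance Definition _ n := gen_eqMixin (mono2 n).
HB.instance Definition _ n := gen_choiceMixin (mono2 n).

HB.lock Definition linext (F : fieldType) (K : choiceType) (V : lmodType F)
    (f : K -> V) (p : {malg F[K]}) : V :=
  \sum_(t <- msupp p) p@_t *: f t.

Arguments linext {F K V} f p.

Section LinearExtension.
Variables (F : fieldType) (K : choiceType) (V : lmodType F).

Lemma linextw (f : K -> V) (d : {fset K}) (p : {malg F[K]}) :
  (msupp p `<=` d)%fset -> linext f p = \sum_(t <- d) p@_t *: f t.
Proof.
move=> le; rewrite unlock; apply: big_fset_incl => // t _ /mcoeff_outdom ->.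
by rewrite scale0r.
Qed.

Fact linext_is_linear (f : K -> V) : linear (linext f).
Proof.
move=> c p q; pose d := (msupp p `|` msupp q `|` msupp (c *: p + q))%fset.
have hp : (msupp p `<=` d)%fset by rewrite /d -fsetUA fsubsetUl.
have hq : (msupp q `<=` d)%fset.
  by rewrite /d fsetUAC fsubsetUr.
have hr : (msupp (c *: p + q) `<=` d)%fset by rewrite fsubsetUr.
rewrite (linextw _ hp) (linextw _ hq) (linextw _ hr) scaler_sumr -big_split /=.
by apply: eq_bigr => t _; rewrite mcoeffD mcoeffZ scalerDl scalerA.
Qed.

HB.instance Definition _ (f : K -> V) :=
  GRing.isLinear.Build F {malg F[K]} V *:%R (linext f) (linext_is_linear f).

Lemma linextU (f : K -> V) t : linext f << t >> = f t.
Proof. by rewrite (linextw _ (msuppU_le)) big_seq_fset1 mcoeffUU scale1r. Qed.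

Lemma eq_linext (f g : K -> V) p : f =1 g -> linext f p = linext g p.
Proof. by move=> fg; rewrite unlock; apply: eq_bigr => t _; rewrite fg. Qed.

Lemma linextB (f g : K -> V) p :
  linext f p - linext g p = linext (fun t => f t - g t) p.
Proof. by rewrite unlock -sumrB; apply: eq_bigr => t _; rewrite scalerBr. Qed.

End LinearExtension.

Lemma linext_comp (F : fieldType) (K K' : choiceType) (V : lmodType F)
    (f : K' -> V) (g : K -> {malg F[K']}) (p : {malg F[K]}) :
  linext f (linext g p) = linext (fun t => linext f (g t)) p.
Proof.
rewrite (linextw g (fsubset_refl _)) linear_sum (linextw _ (fsubset_refl _)).
by apply: eq_bigr => t _; rewrite linearZ.
Qed.

Lemma linext_id (F : fieldType) (K : choiceType) (p : {malg F[K]}) :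
  linext (fun t => << t >>) p = p.
Proof.
rewrite [RHS]monalgE unlock; apply: eq_bigr => t _; apply/malgP => k.
by rewrite mcoeffZ !mcoeffU mulr_natr.
Qed.

Section Series.
Variables (F : fieldType) (A : lmodType F).

(* A((u^-1)): the coefficient of u^k is [f k]. *)
Definition bounded1 : {pred int -> A} :=
  fun f => `[< exists N : int, forall k, N < k -> f k = 0 >].

(* A((u1^-1,u2^-1)): the coefficient of u1^a u2^b is [f (a, b)]. *)
Definition bounded2 : {pred int * int -> A} :=
  fun f => `[< exists N : int, forall a b, N < a \/ N < b -> f (a, b) = 0 >].

Fact bounded1_submod : submod_closed bounded1.
Proof.
split; first by apply/asboolP; exists 0.
move=> c f g /asboolP[N hN] /asboolP[M hM]; apply/asboolP.
exists (Num.max N M) => k; rewrite gt_max => /andP[h1 h2].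
have -> : (c *: f + g) k = c *: f k + g k by [].
by rewrite hN // hM // scaler0 addr0.
Qed.

Fact bounded2_submod : submod_closed bounded2.
Proof.
split; first by apply/asboolP; exists 0.
move=> c f g /asboolP[N hN] /asboolP[M hM]; apply/asboolP.
exists (Num.max N M) => a b; rewrite !gt_max => h.
have hN' : N < a \/ N < b by case: h => /andP[]; [left | right].
have hM' : M < a \/ M < b by case: h => /andP[]; [left | right].
have -> : (c *: f + g) (a, b) = c *: f (a, b) + g (a, b) by [].
by rewrite hN // hM // scaler0 addr0.
Qed.

HB.instance Definition _ :=
  GRing.isSubmodClosed.Build F (int -> A) bounded1 bounded1_submod.
HB.instance Definition _ :=
  GRing.isSubmodClosed.Build F (int * int -> A) bounded2 bounded2_submod.

Record laurent := Laurent { coef1 :> int -> A; coef1P : coef1 \in bounded1 }.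
HB.instance Definition _ := [isSub for coef1].
HB.instance Definition _ := [Choice of laurent by <:].
HB.instance Definition _ := [SubChoice_isSubLmodule of laurent by <:].

Record laurent2 :=
  Laurent2 { coef2 :> int * int -> A; coef2P : coef2 \in bounded2 }.
HB.instance Definition _ := [isSub for coef2].
HB.instance Definition _ := [Choice of laurent2 by <:].
HB.instance Definition _ := [SubChoice_isSubLmodule of laurent2 by <:].

(* u^a f(u) *)
Fact shift1_bounded (a : int) (f : laurent) : (fun k => f (k - a)) \in bounded1.
Proof.
have /asboolP[N hN] := coef1P f; apply/asboolP; exists (N + a) => k hk.
by rewrite hN // ltrBrDr.
Qed.
Definition shift1 a f : laurent := Laurent (shift1_bounded a f).

(* u1^a u2^b f(u1,u2), where s = (a, b) *)
Fact shift2_bounded (s : int * int) (f : laurent2) :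
  (fun k => f (k.1 - s.1, k.2 - s.2)) \in bounded2.
Proof.
have /asboolP[N hN] := coef2P f; apply/asboolP.
exists (Num.max (N + s.1) (N + s.2)) => a b h; rewrite hN //.
by case: h; rewrite gt_max => /andP[? ?]; [left | right]; rewrite ltrBrDr.
Qed.
Definition shift2 s f : laurent2 := Laurent2 (shift2_bounded s f).

(* The product of a Laurent polynomial in u1, u2 and a series; << (a, b) >> is
   u1^a u2^b. *)
Definition lact (p : {malg F[(int * int)%type]}) (f : laurent2) : laurent2 :=
  linext (shift2^~ f) p.

End Series.
Arguments lact {F A}.

Section Ahat.
Variables (F : fieldType) (n : nat).
Local Notation lpol := {malg F[mono2 n]}.

(* P_n *)
Definition Pten : lpol -> lpol :=
  linext (fun t : mono2 n => << Mono2 (mi2 t) (md1 t) (mi1 t) (md2 t) >>).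

(* P_{u1,u2} *)
Definition Pvar : lpol -> lpol :=
  linext (fun t : mono2 n => << Mono2 (mi1 t) (md2 t) (mi2 t) (md1 t) >>).

(* p |-> (u1 - u2)^-1 (p(u1,u2) - p(u2,u1)); on monomials,
     (u1^a u2^b - u1^b u2^a) / (u1 - u2)
        =   \sum_(k < a - b) u1^(a-1-k) u2^(b+k)   if b <= a,
        = - \sum_(k < b - a) u1^(b-1-k) u2^(a+k)   if a <= b. *)
Definition ddiff_mono (t : mono2 n) : lpol :=
  let: Mono2 i a j b := t in
  if b <= a then \sum_(k < `|a - b|) << Mono2 i (a - 1 - k%:Z) j (b + k%:Z) >>
  else - \sum_(k < `|b - a|) << Mono2 i (b - 1 - k%:Z) j (a + k%:Z) >>.

Definition ddiff : lpol -> lpol := linext ddiff_mono.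

Definition Ahat (p : lpol) : lpol :=
  2^-1 *: (p - Pvar (Pten p)) + 2^-1 *: ddiff p.

Definition mulu1 : lpol -> lpol :=
  linext (fun t : mono2 n => << Mono2 (mi1 t) (md1 t + 1) (mi2 t) (md2 t) >>).
Definition mulu2 : lpol -> lpol :=
  linext (fun t : mono2 n => << Mono2 (mi1 t) (md1 t) (mi2 t) (md2 t + 1) >>).

Lemma ddiffP (p : lpol) : mulu1 (ddiff p) - mulu2 (ddiff p) = p - Pvar p.
Proof.
have E3 : p - Pvar p = linext (fun t =>
    << t >> - (<< Mono2 (mi1 t) (md2 t) (mi2 t) (md1 t) >> : lpol)) p.
  by rewrite -linextB linext_id.
rewrite {}E3 /mulu1 /mulu2 /ddiff !linext_comp -/mulu1 -/mulu2 linextB.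
apply: eq_linext => -[i a j b] /=.
have mul1S m (f : 'I_m -> mono2 n) : mulu1 (\sum_k << f k >>) =
    \sum_k << Mono2 (mi1 (f k)) (md1 (f k) + 1) (mi2 (f k)) (md2 (f k)) >>.
  by rewrite /mulu1 [LHS]linear_sum; apply: eq_bigr => k _; exact: linextU.
have mul2S m (f : 'I_m -> mono2 n) : mulu2 (\sum_k << f k >>) =
    \sum_k << Mono2 (mi1 (f k)) (md1 (f k)) (mi2 (f k)) (md2 (f k) + 1) >>.
  by rewrite /mulu2 [LHS]linear_sum; apply: eq_bigr => k _; exact: linextU.
have eqm (x y z t x' y' z' t' : int) : x = x' -> y = y' -> z = z' -> t = t' ->
    << Mono2 i x j y >> - << Mono2 i z j t >> =
    << Mono2 i x' j y' >> - << Mono2 i z' j t' >> :> lpol.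
  by move=> -> -> -> ->.
have tele (x y : int) m : x = y + m%:Z ->
    mulu1 (\sum_(k < m) << Mono2 i (x - 1 - k%:Z) j (y + k%:Z) >>)
    - mulu2 (\sum_(k < m) << Mono2 i (x - 1 - k%:Z) j (y + k%:Z) >>)
    = << Mono2 i x j y >> - << Mono2 i y j x >>.
  move=> ->; rewrite mul1S mul2S /= -sumrB.
  pose f (k : nat) : lpol := - << Mono2 i (y + m%:Z - k%:Z) j (y + k%:Z) >>.
  rewrite (eq_bigr (fun k : 'I_m => f k.+1 - f k)); last first.
    move=> k _; rewrite /f opprK [RHS]addrC.
    by apply: eqm; lia.
  rewrite -(big_mkord xpredT (fun k => f k.+1 - f k)) telescope_sumr // /f.
  by rewrite opprK addrC; apply: eqm; lia.
have mul1N q : mulu1 (- q) = - mulu1 q by exact: linearN.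
have mul2N q : mulu2 (- q) = - mulu2 q by exact: linearN.
clear -tele mul1N mul2N; case: leP => hab; first by apply: tele; lia.
by rewrite mul1N mul2N -opprD -[RHS]opprB; congr (- _); apply: tele; lia.
Qed.

Lemma AhatU (t : mono2 n) : Ahat << t >> =
  2^-1 *: (<< t >> - << Mono2 (mi2 t) (md2 t) (mi1 t) (md1 t) >>)
    + 2^-1 *: ddiff_mono t.
Proof. by rewrite /Ahat /Pten /Pvar /ddiff !linextU. Qed.

Lemma Ahat_supp (t z : mono2 n) :
  ~~ [&& md1 z <= Num.max (md1 t) (md2 t), md2 z <= Num.max (md1 t) (md2 t)
       & md1 z + md2 z <= md1 t + md2 t] -> (Ahat << t >>)@_z = 0.
Proof.
move=> h; have mon0 (s : mono2 n) :
    [&& md1 s <= Num.max (md1 t) (md2 t), md2 s <= Num.max (md1 t) (md2 t)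
      & md1 s + md2 s <= md1 t + md2 t] -> (<< s >> : lpol)@_z = 0.
  move=> hs; rewrite mcoeffU; case: eqP => // E.
  by rewrite -E hs in h.
rewrite AhatU mcoeffD 2!mcoeffZ mcoeffB (mon0 t); last by lia.
rewrite mon0 /=; last by lia.
suff -> : (ddiff_mono t)@_z = 0 by rewrite subr0 !mulr0 addr0.
case: t h mon0 => i a j b /= h mon0.
case: ifP => hab; rewrite ?mcoeffN raddf_sum /= big1 ?oppr0 // => k _;
  rewrite mon0 //=; have := ltn_ord k; lia.
Qed.

End Ahat.
Arguments ddiff_mono {F n} t.

Section AhatSeries.
Variables (F : fieldType) (A : lmodType F) (n : nat).

(* A((u1^-1,u2^-1)) (x) C^n (x) C^n: the component along e_i (x) e_j is f (i, j). *)
Local Notation ser := {ffun 'I_n * 'I_n -> laurent2 A}.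

Fact ser_bounded (f : ser) :
  exists N : int, forall ij a b, N < a \/ N < b -> f ij (a, b) = 0.
Proof.
have /choice[g hg] : forall ij, exists N : int,
    forall a b, N < a \/ N < b -> f ij (a, b) = 0.
  by move=> ij; have /asboolP := coef2P (f ij).
exists (\sum_ij `|g ij|) => ij a b h; apply: hg.
have le : g ij <= \sum_ij `|g ij|.
  apply: le_trans (ler_norm _) _; rewrite (bigD1 ij) //= lerDl.
  by apply: sumr_ge0 => k _; exact: normr_ge0.
by case: h => h; [left | right]; apply: le_lt_trans le h.
Qed.

(* Coefficient of z in the image under Ahat of the monomial t of f. *)
Definition Ahat_term (f : ser) (z t : mono2 n) : A :=
  (Ahat << t >>)@_z *: f (mi1 t, mi2 t) (md1 t, md2 t).

(* Only finitely many monomials of f contribute to a given monomial of Ahat f. *)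
Lemma Ahat_term_finite f z : finite_set [set t | Ahat_term f z t != 0].
Proof.
have [N hN] := ser_bounded f.
pose m := md1 z + md2 z - N.
pose g (x : 'I_n * 'I_n * ('I_`|N - m|.+1 * 'I_`|N - m|.+1)) : mono2 n :=
  Mono2 x.1.1 (m + (x.2.1 : nat)%:Z) x.1.2 (m + (x.2.2 : nat)%:Z).
apply: (@sub_finite_set _ _ (g @` setT)%classic); last first.
  by apply: finite_image; exact: finite_finset.
move=> [i a j b] /=; rewrite /Ahat_term => /eqP h.
have [ha hb] : a <= N /\ b <= N.
  by split; rewrite leNgt; apply/negP => hab; apply: h;
    rewrite hN ?scaler0 //=; [left | right].
have hs : md1 z + md2 z <= a + b.
  rewrite leNgt; apply/negP => hab; apply: h; rewrite Ahat_supp ?scale0r //=.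
  by rewrite !negb_and -!ltNge hab !orbT.
have ka : (`|a - m| < `|N - m|.+1)%N by rewrite /m in hs *; lia.
have kb : (`|b - m| < `|N - m|.+1)%N by rewrite /m in hs *; lia.
exists ((i, j), (Ordinal ka, Ordinal kb)) => //.
by rewrite /g /=; congr (Mono2 _ _ _ _); rewrite /m in hs *; lia.
Qed.

(* Continuous extension of Ahat to series: the image of a series is the sum of
   the images of its monomials. *)
Definition Ahat_coef (f : ser) (z : mono2 n) : A :=
  \sum_(t \in [set: mono2 n]) Ahat_term f z t.

Fact Ahat_coef_bounded f ij :
  (fun k => Ahat_coef f (Mono2 ij.1 k.1 ij.2 k.2)) \in @bounded2 F A.
Proof.
have [N hN] := ser_bounded f; apply/asboolP; exists N => a b h.
apply: fsbig1 => -[i c j d] _; rewrite /Ahat_term /=.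
have [hcd | hcd] := pselect (N < c \/ N < d); first by rewrite hN ?scaler0.
rewrite Ahat_supp ?scale0r //=.
have hc : c <= N by rewrite leNgt; apply/negP => ?; apply: hcd; left.
have hd : d <= N by rewrite leNgt; apply/negP => ?; apply: hcd; right.
by case: h => h; lia.
Qed.

Definition Ahat_ser (f : ser) : ser :=
  [ffun ij => Laurent2 (Ahat_coef_bounded f ij)].

End AhatSeries.

Section Manin.
Variables (F : fieldType) (A : algType F).

(* f(u1) g(u2) and g(u2) f(u1) *)
Fact mul12_bounded (f g : laurent A) : (fun k => f k.1 * g k.2) \in @bounded2 F A.
Proof.
have /asboolP[N hN] := coef1P f; have /asboolP[M hM] := coef1P g.
apply/asboolP; exists (Num.max N M) => a b; rewrite !gt_max /=.
by case=> /andP[? ?]; [rewrite hN // mul0r | rewrite hM // mulr0].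
Qed.
Definition mul12 f g : laurent2 A := Laurent2 (mul12_bounded f g).

Fact mul21_bounded (f g : laurent A) : (fun k => g k.2 * f k.1) \in @bounded2 F A.
Proof.
have /asboolP[N hN] := coef1P f; have /asboolP[M hM] := coef1P g.
apply/asboolP; exists (Num.max N M) => a b; rewrite !gt_max /=.
by case=> /andP[? ?]; [rewrite hN // mulr0 | rewrite hM // mul0r].
Qed.
Definition mul21 f g : laurent2 A := Laurent2 (mul21_bounded f g).

(* Operators C^m[u,u^-1] -> A((u^-1)) (x) C^n *)
Definition lop (m n : nat) :=
  {linear {malg F[mono m]} -> {ffun 'I_n -> laurent A}}.

(* M^(1) M^(2), given by (M^(1) M^(2)) (v (x) w) = (M v)(u1) (x) (M w)(u2) on
   the basis e_k u1^a (x) e_l u2^b of C^m[u1,u1^-1] (x) C^m[u2,u2^-1]. *)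
Definition lop12 m n (M : lop m n) :
    {malg F[mono2 m]} -> {ffun 'I_n * 'I_n -> laurent2 A} :=
  linext (fun t => [ffun ij =>
    mul12 (M << Mono (mi1 t) (md1 t) >> ij.1) (M << Mono (mi2 t) (md2 t) >> ij.2)]).

Definition is_Manin m n (M : lop m n) :=
  forall p, Ahat_ser (lop12 M (p - Ahat p)) = 0.

(* Multiplication by the matrix L(u) : e_k u^a |-> \sum_i L^i_k(u) u^a e_i *)
Definition lop_of_mx m n (L : 'M[laurent A]_(n, m)) : lop m n :=
  linext (fun t : mono m => [ffun i => shift1 (md t) (L i (mi t))]).

Lemma lop12_of_mx m n (L : 'M[laurent A]_(n, m)) (t : mono2 m) ij :
  lop12 (lop_of_mx L) << t >> ij =
  shift2 (md1 t, md2 t) (mul12 (L ij.1 (mi1 t)) (L ij.2 (mi2 t))).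
Proof.
have E k a : lop_of_mx L << Mono k a >> = [ffun i => shift1 a (L i k)].
  exact: linextU.
by rewrite /lop12 linextU ffunE !E !ffunE; apply: val_inj.
Qed.

(* R_n(w) = w - P_n, as a matrix with rows and columns indexed by 'I_n * 'I_n,
   where w is a Laurent polynomial in u1, u2. *)
Definition Rmx n (w : {malg F[(int * int)%type]}) (I J : 'I_n * 'I_n) :
    {malg F[(int * int)%type]} :=
  w *+ (I == J) - << (0, 0) >> *+ (I == (J.2, J.1)).

Definition u1Bu2 : {malg F[(int * int)%type]} := << (1, 0) >> - << (0, 1) >>.

Definition L1L2 m n (L : 'M[laurent A]_(n, m)) (I : 'I_n * 'I_n) (K : 'I_m * 'I_m) :=
  mul12 (L I.1 K.1) (L I.2 K.2).

Definition L2L1 m n (L : 'M[laurent A]_(n, m)) (I : 'I_n * 'I_n) (K : 'I_m * 'I_m) :=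
  mul21 (L I.1 K.1) (L I.2 K.2).

Definition RLL m n (L : 'M[laurent A]_(n, m)) :=
  forall (I : 'I_n * 'I_n) (K : 'I_m * 'I_m),
    \sum_J lact (Rmx u1Bu2 I J) (L1L2 L J K) =
    \sum_J lact (Rmx u1Bu2 J K) (L2L1 L I J).

End Manin.

(* Main.v *)
(* Put w = u1 - u2 and sigma = P_{u1,u2} P_n.  Clearing the denominator, and
   using that multiplication by w is injective on series, Ahat_n f = 0 means
     R_n(w) f = (w - 1) sigma f,
   and every polynomial q in the image of 1 - Ahat_m satisfies the same relation
   R_m(w) q = (w - 1) sigma q.  Let G and H be multiplication by L1(u1) L2(u2)
   and L2(u2) L1(u1), so that sigma G = H sigma.  For such q,
     R_n(w) G q - (w - 1) sigma G q = R_n(w) G q - H (w - 1) sigma q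
                                    = (R_n(w) G - H R_m(w)) q,
   so L is Manin iff the defect Z = R_n(w) G - H R_m(w) kills the image of
   1 - Ahat_m.  That image contains e_k e_l + e_l e_k and
   u1 e_k e_l + u2 e_l e_k - e_k e_l, which gives (u1 - u2 - 1) Z_{kl} = 0; as
   u1 - u2 - 1 is injective on series, Z = 0. *)
Require Import Defs.
From HB Require Import structures.
From mathcomp Require Import all_boot all_order all_algebra finmap.
From mathcomp Require Import monalg.
From mathcomp Require Import boolp classical_sets functions cardinality fsbigop.
From mathcomp Require Import zify ring reals complex.

Set Implicit Arguments.
Unset Strict Implicit.
Unset Printing Implicit Defensive.

Import Order.TTheory GRing.Theory Num.Theory.
Local Open Scope ring_scope.

(** * Permutations and shifts of monomials *)

Section Monomials.
Variable n : nat.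
Implicit Types t : mono2 n.

(* P_n, P_{u1,u2} and P_{u1,u2} P_n on monomials *)
Definition swapi t := Mono2 (mi2 t) (md1 t) (mi1 t) (md2 t).
Definition swapd t := Mono2 (mi1 t) (md2 t) (mi2 t) (md1 t).
Definition swap t := Mono2 (mi2 t) (md2 t) (mi1 t) (md1 t).
Definition up1 t := Mono2 (mi1 t) (md1 t + 1) (mi2 t) (md2 t).
Definition up2 t := Mono2 (mi1 t) (md1 t) (mi2 t) (md2 t + 1).
Definition down1 t := Mono2 (mi1 t) (md1 t - 1) (mi2 t) (md2 t).
Definition down2 t := Mono2 (mi1 t) (md1 t) (mi2 t) (md2 t - 1).

Lemma swapdK : involutive swapd. Proof. by case. Qed.
Lemma swapK : involutive swap. Proof. by case. Qed.
Lemma up1K : cancel up1 down1.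
Proof. by case=> i a j b; rewrite /down1 /= addrK. Qed.
Lemma up2K : cancel up2 down2.
Proof. by case=> i a j b; rewrite /down2 /= addrK. Qed.
Lemma down1K : cancel down1 up1.
Proof. by case=> i a j b; rewrite /up1 /= subrK. Qed.
Lemma down2K : cancel down2 up2.
Proof. by case=> i a j b; rewrite /up2 /= subrK. Qed.

End Monomials.

(** Additive core of [comp_Ahat_R]. There [i], [d], [s] are the images of [p] under $P_n$,
    $P_{u_1,u_2}$ and their product, $q$ is the divided difference of [p], $r=P_nq$ and $y=p+s$; the
    indices 1, 2 mark multiplication by $u_1$, $u_2$. *)
Lemma exchange_differences (V : zmodType) (y1 y2 q1 q2 r r1 r2 p s i d : V) :
  q1 - q2 = p - d -> r1 - r2 = i - s ->
  (y1 - q1) - (y2 - q2) - ((i + d) - r) = (y1 - r1) - (y2 - r2) - ((p + s) - r).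
Proof.
have BB (a b c e : V) : (a - b) - (c - e) = (a - c) - (b - e).
  by rewrite !opprB (AC (2*2) ((1*4)*(3*2))).
rewrite (BB y1 q1) (BB y1 r1) => -> ->; rewrite -!addrA !opprD !opprK.
do 2!congr (_ + _); rewrite !addrA; congr (_ + _).
by rewrite [LHS]addrAC addrK [RHS]addrAC addrK addrC.
Qed.

(** Common form of $P_n$, $P_{u_1,u_2}$ and multiplication by $u_1$, $u_2$, so that their
    compositions are compared on monomials. *)
HB.lock Definition mapmono (F : fieldType) n (f : mono2 n -> mono2 n) :
    {malg F[mono2 n]} -> {malg F[mono2 n]} :=
  linext (fun t => << f t >>).
Arguments mapmono {F n} f p.

(** * Divided differences and the image of $1-\widehat A$ on Laurent polynomials *)

Section LaurentPolynomials.
Variables (F : fieldType) (n : nat).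
Local Notation lpol := {malg F[mono2 n]}.
Implicit Types (p q : lpol) (t z : mono2 n) (f g : mono2 n -> mono2 n).

Lemma mapmono0 f : @mapmono F n f 0 = 0.
Proof. by rewrite unlock; exact: linear0. Qed.

Lemma mapmonoD f : {morph @mapmono F n f : p q / p + q}.
Proof. by rewrite unlock; exact: linearD. Qed.

Lemma mapmonoN f : {morph @mapmono F n f : p / - p}.
Proof. by rewrite unlock; exact: linearN. Qed.

Lemma mapmonoB f : {morph @mapmono F n f : p q / p - q}.
Proof. by rewrite unlock; exact: linearB. Qed.

Lemma mapmonoZ f c : {morph @mapmono F n f : p / c *: p}.
Proof. by rewrite unlock; exact: linearZ. Qed.

Lemma mapmonoU f t : mapmono f << t >> = << f t >> :> lpol.
Proof. by rewrite unlock linextU. Qed.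

Lemma mapmono_linext f (h : mono2 n -> lpol) p :
  mapmono f (linext h p) = linext (fun t => mapmono f (h t)) p.
Proof. by rewrite mapmono.unlock linext_comp. Qed.

Lemma mapmono_comp f g p : mapmono f (mapmono g p) = mapmono (f \o g) p.
Proof.
by rewrite unlock linext_comp; apply: eq_linext => t; rewrite linextU.
Qed.

Lemma eq_mapmono f g p : f =1 g -> mapmono f p = mapmono g p.
Proof. by move=> fg; rewrite unlock; apply: eq_linext => t; rewrite fg. Qed.

Lemma mapmono_id p : mapmono id p = p.
Proof. by rewrite unlock linext_id. Qed.

Lemma mcoeff_mapmono f g p z :
  cancel f g -> cancel g f -> (mapmono f p)@_z = p@_(g z).
Proof.
move=> fK gK; rewrite [in RHS](monalgE p) mapmono.unlock linext.unlock.
rewrite !raddf_sum /=.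
apply: eq_bigr => t _; rewrite mcoeffZ !mcoeffU mulr_natr.
by rewrite -{1}[z]gK (inj_eq (can_inj fK)).
Qed.

Lemma PtenE : @Pten F n = mapmono (@swapi n). Proof. by rewrite unlock. Qed.
Lemma PvarE : @Pvar F n = mapmono (@swapd n). Proof. by rewrite unlock. Qed.
Lemma mulu1E : @mulu1 F n = mapmono (@up1 n). Proof. by rewrite unlock. Qed.
Lemma mulu2E : @mulu2 F n = mapmono (@up2 n). Proof. by rewrite unlock. Qed.

Lemma PvarPten p : Pvar (Pten p) = mapmono (@swap n) p.
Proof. by rewrite PtenE PvarE mapmono_comp; apply: eq_mapmono; case. Qed.

(** Numerator and denominator both change sign under $u_1\leftrightarrow u_2$; on a monomial the
    exchange reverses the order of the sum. *)
Lemma Pvar_ddiff p : Pvar (ddiff p) = ddiff p.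
Proof.
rewrite PvarE mapmono_linext; apply: eq_linext => -[i a j b] /=.
have sym (x y : int) m : x = y + m%:Z ->
    mapmono (@swapd n) (\sum_(k < m) << Mono2 i (x - 1 - k%:Z) j (y + k%:Z) >>)
    = \sum_(k < m) << Mono2 i (x - 1 - k%:Z) j (y + k%:Z) >> :> lpol.
  move=> ->; rewrite (big_morph _ (mapmonoD _) (mapmono0 _)).
  rewrite (reindex_inj rev_ord_inj) /=.
  apply: eq_bigr => k _; rewrite mapmonoU /swapd /=.
  by congr (<< Mono2 _ _ _ _ >>); have := ltn_ord k; lia.
case: ifP => hab; first by apply: sym; lia.
by rewrite mapmonoN sym //; lia.
Qed.

(* (u1 - u2) Ahat, in which the division by u1 - u2 disappears. *)
Lemma mcoeff_Ahat p z :
  (Ahat p)@_(down1 z) - (Ahat p)@_(down2 z) =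
  2^-1 * (p@_(down1 z) - p@_(down2 z) - p@_(swap (down1 z))
          + p@_(swap (down2 z)) + p@_z - p@_(swapd z)).
Proof.
have cS q y : (mapmono (@swap n) q)@_y = q@_(swap y).
  by rewrite (mcoeff_mapmono _ _ (@swapK n) (@swapK n)).
have cD q y : (mapmono (@swapd n) q)@_y = q@_(swapd y).
  by rewrite (mcoeff_mapmono _ _ (@swapdK n) (@swapdK n)).
have c1 q y : (mulu1 q)@_y = q@_(down1 y).
  by rewrite mulu1E (mcoeff_mapmono _ _ (@up1K n) (@down1K n)).
have c2 q y : (mulu2 q)@_y = q@_(down2 y).
  by rewrite mulu2E (mcoeff_mapmono _ _ (@up2K n) (@down2K n)).
have := congr1 (mcoeff z) (ddiffP p).
rewrite !mcoeffB c1 c2 PvarE cD => H.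
rewrite /Ahat PvarPten !mcoeffD !mcoeffZ !mcoeffB !cS.
have -> : (ddiff p)@_(down1 z) = p@_z - p@_(swapd z) + (ddiff p)@_(down2 z).
  by rewrite -H subrK.
by ring.
Qed.

Lemma comp_AhatE p : (2 : F) != 0 ->
  p - Ahat p = 2^-1 *: (p + mapmono (@swap n) p - ddiff p).
Proof.
move=> F2; have {1}-> : p = 2^-1 *: (p + p).
  by rewrite -mulr2n -scaler_nat scalerA mulVf // scale1r.
rewrite /Ahat PvarPten -scalerDr -scalerBr; congr (_ *: _).
by rewrite opprD opprB addrA addrACA subrr addr0.
Qed.

(* The image of 1 - Ahat satisfies R(u1 - u2) p = (u1 - u2 - 1) P_u P_n p. *)
Lemma comp_Ahat_R p : (2 : F) != 0 -> let q := p - Ahat p in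
  mulu1 q - mulu2 q - Pten q =
  mulu1 (mapmono (@swap n) q) - mulu2 (mapmono (@swap n) q)
    - mapmono (@swap n) q.
Proof.
move=> F2 /=; have := ddiffP p; have := Pvar_ddiff p.
rewrite comp_AhatE // PtenE PvarE mulu1E mulu2E.
set q := ddiff p => symq divq.
(* As $q$ is symmetric in the variables, $P_{u_1,u_2}P_n$ acts on it as $P_n$. *)
have swq : mapmono (@swap n) q = mapmono (@swapi n) q.
  by rewrite -[in RHS]symq mapmono_comp; apply: eq_mapmono; case.
(* $P_n$ commutes with multiplication by $u_1-u_2$, so it can be applied to [divq]. *)
have divPq : mapmono (@up1 n) (mapmono (@swapi n) q)
    - mapmono (@up2 n) (mapmono (@swapi n) q)
    = mapmono (@swapi n) p - mapmono (@swap n) p.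
  transitivity (mapmono (@swapi n) (p - mapmono (@swapd n) p)); last first.
    by rewrite mapmonoB mapmono_comp; congr (_ - _); apply: eq_mapmono; case.
  by rewrite -divq mapmonoB !mapmono_comp.
have swK : mapmono (@swap n) (mapmono (@swap n) p) = p.
  by rewrite mapmono_comp -[RHS]mapmono_id; apply: eq_mapmono; case.
have swi : mapmono (@swapi n) (mapmono (@swap n) p) = mapmono (@swapd n) p.
  by rewrite mapmono_comp; apply: eq_mapmono; case.
rewrite !mapmonoZ -!scalerBr; congr (_ *: _).
set y := p + _; have swy : mapmono (@swap n) y = y.
  by rewrite mapmonoD swK addrC.
have swiy : mapmono (@swapi n) y =
    mapmono (@swapi n) p + mapmono (@swapd n) p.
  by rewrite mapmonoD swi.
rewrite !mapmonoB swq swy swiy.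
exact: exchange_differences divq divPq.
Qed.

End LaurentPolynomials.

(** * The kernel of $\widehat A$ on series *)

Section Series.
Variables (F : fieldType) (A : lmodType F).

(* u1 - u2 - c is injective: modulo terms of higher total degree, the equation
   makes g constant along each antidiagonal, which leaves the support. *)
Lemma laurent2_eq0 (c : F) (g : laurent2 A) :
  (forall a b, g (a - 1, b) - g (a, b - 1) = c *: g (a, b)) ->
  forall a b, g (a, b) = 0.
Proof.
move=> eqg; have /asboolP[N hN] := coef2P g.
(* Descending induction on the total degree: above $2N$ one of the exponents exceeds $N$. *)
have vanish (k : nat) a b : N + N < a + b + k%:Z -> g (a, b) = 0.
  elim: k a b => [|k IHk] a b hab; first by apply: hN; lia.
  have shift x y : N + N < x + y + k.+1%:Z -> g (x, y) = g (x + 1, y - 1).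
    move=> hxy; have := eqg (x + 1) y.
    rewrite addrK (IHk (x + 1) y); last by lia.
    by rewrite scaler0 => /eqP; rewrite subr_eq0 => /eqP.
  have shiftn j : g (a, b) = g (a + j%:Z, b - j%:Z).
    elim: j => [|j ->]; first by rewrite addr0 subr0.
    rewrite shift; last by lia.
    by congr (g (_, _)); lia.
  by rewrite (shiftn (`|N - a|.+1)%N) hN //; left; lia.
by move=> a b; apply: (vanish (`|(N + N - a - b)%R|.+1)%N); lia.
Qed.

Variable n : nat.
Local Notation ser := {ffun 'I_n * 'I_n -> laurent2 A}.
Implicit Types (f : ser) (z t : mono2 n).

Definition sercoef f z : A := f (mi1 z, mi2 z) (md1 z, md2 z).

(** Each coefficient of $\widehat Af$ is a finite sum over monomials of $f$, so [mcoeff_Ahat] can be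
    summed term by term. *)
Lemma Ahat_coef_div f z :
  Ahat_coef f (down1 z) - Ahat_coef f (down2 z) =
  2^-1 *: (sercoef f (down1 z) - sercoef f (down2 z)
    - sercoef f (swap (down1 z)) + sercoef f (swap (down2 z))
    + sercoef f z - sercoef f (swapd z)).
Proof.
pose S y := [set t | Ahat_term f y t != 0]%classic.
pose P :=
  [fset down1 z; down2 z; swap (down1 z); swap (down2 z); z; swapd z]%fset.
(* One index set for every sum: the supports of both sums on the left and the six monomials read off
   on the right. *)
pose X := (fset_set (S (down1 z)) `|` fset_set (S (down2 z)) `|` P)%fset.
have AhatX y : y = down1 z \/ y = down2 z ->
    Ahat_coef f y = \sum_(t <- X) (Ahat << t >>)@_y *: sercoef f t.
  move=> hy; apply: fsbigTE => t; apply: contraNeq => ht.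
  have St : t \in S y by exact: mem_set.
  rewrite !in_fsetU !in_fset_set; try exact: Ahat_term_finite.
  by case: hy St => -> ->; rewrite ?orbT.
have delta s : s \in P ->
    \sum_(t <- X) (<< t >>)@_s *: sercoef f t = sercoef f s.
  move=> sP; have sX : s \in X by rewrite in_fsetU sP orbT.
  rewrite (big_fsetD1 s) //= mcoeffUU scale1r big1_fset ?addr0 // => t.
  by rewrite in_fsetD1 => /andP[/negPf ts _] _; rewrite mcoeffU ts scale0r.
rewrite !AhatX; [|by right|by left].
rewrite -!delta; try by rewrite !inE eqxx ?orbT.
rewrite -!(sumrB, big_split) /= scaler_sumr; apply: eq_bigr => t _.
rewrite -scalerBl mcoeff_Ahat -scalerA; congr (_ *: _).
by rewrite !(scalerBl, scalerDl).
Qed.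

(* R(u1 - u2) f = (u1 - u2 - 1) P_u P_n f *)
Lemma Ahat_ser_eq0 f : (2 : F) != 0 ->
  Ahat_ser f = 0 <->
  forall z, sercoef f (down1 z) - sercoef f (down2 z) - sercoef f (swapi z) =
    sercoef f (swap (down1 z)) - sercoef f (swap (down2 z))
      - sercoef f (swap z).
Proof.
move=> F2; have coefE : Ahat_ser f = 0 <-> forall z, Ahat_coef f z = 0.
  split=> [f0 z|f0].
    have := congr1 (fun g : ser => g (mi1 z, mi2 z) (md1 z, md2 z)) f0.
    by rewrite !ffunE; case: z.
  apply/ffunP => ij; rewrite !ffunE; apply: val_inj.
  by apply/funext => -[a b] /=.
(* Multiplication by $u_1-u_2$ is injective: [laurent2_eq0] with $c=0$. *)
have AhatE : (forall z, Ahat_coef f z = 0) <->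
    forall z, Ahat_coef f (down1 z) - Ahat_coef f (down2 z) = 0.
  split=> [f0 z|f0 [i a j b]]; first by rewrite !f0 subr0.
  have : Ahat_ser f (i, j) (a, b) = 0; last by rewrite ffunE.
  apply: (@laurent2_eq0 0) => {}a {}b.
  by rewrite scale0r ffunE; apply: (f0 (Mono2 i a j b)).
(* At [swap z] the six terms of [Ahat_coef_div] regroup into the difference of the two sides of the
   claim. *)
have bracketE z : Ahat_coef f (down1 (swap z)) - Ahat_coef f (down2 (swap z)) =
    2^-1 *: ((sercoef f (down1 z) - sercoef f (down2 z) - sercoef f (swapi z))
      - (sercoef f (swap (down1 z)) - sercoef f (swap (down2 z))
        - sercoef f (swap z))).
  rewrite Ahat_coef_div; congr (_ *: _); case: z => i a j b.
  rewrite /down1 /down2 /swap /swapd /swapi /= !opprB.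
  by rewrite [LHS](AC 6 ((4*3*6)*(5*(1*2)))).
rewrite coefE AhatE; split=> f0 z; last first.
  by rewrite -[z]swapK bracketE f0 subrr scaler0.
move/eqP: (f0 (swap z)); rewrite bracketE scaler_eq0 invr_eq0 (negPf F2) /=.
by rewrite subr_eq0 => /eqP.
Qed.

End Series.

(** * Matrices of series acting on Laurent polynomials *)

Section Action.
Variables (F : fieldType) (A : lmodType F) (m n : nat).
Local Notation kernel := ('I_n * 'I_n -> 'I_m * 'I_m -> int * int -> A).
Implicit Types (Z : kernel) (p : {malg F[mono2 m]}) (z : mono2 n).

(* Coefficient of the monomial z in the product of p by the matrix Z. *)
Definition kact Z p z : A :=
  linext (fun t => Z (mi1 z, mi2 z) (mi1 t, mi2 t)
                     (md1 z - md1 t, md2 z - md2 t)) p.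

Lemma kact0 Z z : kact Z 0 z = 0.
Proof. exact: linear0. Qed.

Lemma kactD Z p q z : kact Z (p + q) z = kact Z p z + kact Z q z.
Proof. exact: linearD. Qed.

Lemma kactB Z p q z : kact Z (p - q) z = kact Z p z - kact Z q z.
Proof. exact: linearB. Qed.

Lemma kactZ Z c p z : kact Z (c *: p) z = c *: kact Z p z.
Proof. exact: linearZ. Qed.

Lemma kactU Z t z : kact Z << t >> z =
  Z (mi1 z, mi2 z) (mi1 t, mi2 t) (md1 z - md1 t, md2 z - md2 t).
Proof. exact: linextU. Qed.

Lemma kact_mapmono Z Z' (f : mono2 m -> mono2 m) p z z' :
  (forall t, kact Z << f t >> z = kact Z' << t >> z') ->
  kact Z (mapmono f p) z = kact Z' p z'.
Proof.
move=> ZZ'; rewrite /kact mapmono.unlock linext_comp; apply: eq_linext => t.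
by rewrite linextU -kactU ZZ' kactU.
Qed.

Lemma kact_mulu1 Z p z : kact Z (mulu1 p) z = kact Z p (down1 z).
Proof.
rewrite mulu1E; apply: kact_mapmono => t; rewrite !kactU /=.
by congr (Z _ _ (_, _)); lia.
Qed.

Lemma kact_mulu2 Z p z : kact Z (mulu2 p) z = kact Z p (down2 z).
Proof.
rewrite mulu2E; apply: kact_mapmono => t; rewrite !kactU /=.
by congr (Z _ _ (_, _)); lia.
Qed.

End Action.

Section Lact.
Variables (F : fieldType) (A : lmodType F).
Implicit Types (p q : {malg F[(int * int)%type]}) (f g : laurent2 A).

Lemma lactB p q f : lact (p - q) f = lact p f - lact q f.
Proof. exact: linearB. Qed.

Lemma lactMn p f k : lact (p *+ k) f = lact p f *+ k.
Proof. exact: linearMn. Qed.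

Lemma lactU s f : lact << s >> f = shift2 s f.
Proof. exact: linextU. Qed.

Lemma coef2B f g x : (f - g) x = f x - g x.
Proof. by []. Qed.

Lemma lact_u1Bu2 f a b :
  lact (u1Bu2 F) f (a, b) = f (a - 1, b) - f (a, b - 1).
Proof. by rewrite lactB !lactU coef2B /= !subr0. Qed.

Lemma lact_1 f : lact << (0, 0) >> f = f.
Proof.
by apply: val_inj; rewrite lactU; apply/funext => -[a b] /=; rewrite !subr0.
Qed.

End Lact.

(** * The defect of the $RLL$-relation and the Manin condition *)

Section RLLManin.
Variables (F : fieldType) (A : algType F) (m n : nat).
Variable L : 'M[laurent A]_(n, m).
Implicit Types (p : {malg F[mono2 m]}) (z : mono2 n).

Local Notation u12 := (u1Bu2 F).

Let G (I : 'I_n * 'I_n) (K : 'I_m * 'I_m) : int * int -> A := L1L2 L I K.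
Let H (I : 'I_n * 'I_n) (K : 'I_m * 'I_m) : int * int -> A := L2L1 L I K.

Lemma sercoef_lop12 p z : sercoef (lop12 (lop_of_mx L) p) z = kact G p z.
Proof.
have -> : lop12 (lop_of_mx L) p =
    linext (fun t => lop12 (lop_of_mx L) << t >>) p.
  by apply: eq_linext => t; rewrite /lop12 linextU.
rewrite /sercoef /kact !linext.unlock sum_ffunE.
have coef2_sum (r : seq (mono2 m)) (f : mono2 m -> laurent2 A) ab :
    (\sum_(t <- r) f t) ab = \sum_(t <- r) f t ab.
  by elim: r => [|t r IHr]; rewrite ?big_nil ?big_cons //= -IHr.
rewrite coef2_sum; apply: eq_bigr => t _; rewrite ffunE.
have -> (c : F) (f : laurent2 A) x : (c *: f) x = c *: f x by [].
by rewrite lop12_of_mx.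
Qed.

(** This is $\sigma G=H\sigma$: exchanging factors and variables together keeps the order of the
    product in $\mathfrak R$. *)
Lemma kact_swap p z : kact H (mapmono (@swap m) p) z = kact G p (swap z).
Proof. by apply: kact_mapmono => t; rewrite !kactU. Qed.

Lemma sum_lact_Rmx k (f : 'I_k * 'I_k -> laurent2 A) K :
  \sum_J lact (Rmx u12 J K) (f J) = lact u12 (f K) - f (K.2, K.1).
Proof.
have RmxE J : lact (Rmx u12 J K) (f J) =
    (if J == K then lact u12 (f K) else 0)
    - (if J == (K.2, K.1) then f (K.2, K.1) else 0).
  rewrite /Rmx lactB !lactMn lact_1.
  by congr (_ - _); case: eqP => [->|].
by rewrite (eq_bigr _ (fun J _ => RmxE J)) sumrB -!big_mkcond !big_pred1_eq.
Qed.

(** Symmetry lets [sum_lact_Rmx] evaluate row sums as well as column sums. *)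
Lemma RmxC k w (I J : 'I_k * 'I_k) : Rmx w I J = Rmx w J I :> {malg F[_]}.
Proof.
rewrite /Rmx eq_sym; congr (_ - _ *+ nat_of_bool _).
case: I J => [i1 i2] [j1 j2]; rewrite !xpair_eqE /=.
by rewrite andbC (eq_sym i1) (eq_sym i2).
Qed.

Definition defect (I : 'I_n * 'I_n) (K : 'I_m * 'I_m) : laurent2 A :=
  \sum_J lact (Rmx u12 I J) (L1L2 L J K) -
  \sum_J lact (Rmx u12 J K) (L2L1 L I J).

Lemma defectE I K a b : defect I K (a, b) =
  G I K (a - 1, b) - G I K (a, b - 1) - G (I.2, I.1) K (a, b)
  - (H I K (a - 1, b) - H I K (a, b - 1) - H I (K.2, K.1) (a, b)).
Proof.
rewrite /defect; under eq_bigr => J _ do rewrite RmxC.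
rewrite (sum_lact_Rmx (fun J => L1L2 L J K)) (sum_lact_Rmx (L2L1 L I)).
by rewrite !coef2B !lact_u1Bu2.
Qed.

Let D I K : int * int -> A := defect I K.

(** In $R_n(w)G-HR_m(w)$ the left factor acts on output monomials, and the right one is moved onto
    [p]. *)
Lemma kact_defect p z : kact D p z =
  kact G p (down1 z) - kact G p (down2 z) - kact G p (swapi z)
  - kact H (mulu1 p - mulu2 p - Pten p) z.
Proof.
rewrite !kactB kact_mulu1 kact_mulu2 PtenE.
pose HP I K := H I (K.2, K.1).
rewrite (@kact_mapmono _ _ _ _ _ HP _ _ _ z) => [|t]; last by rewrite !kactU.
rewrite /kact !linextB; apply: eq_linext => t; rewrite /D defectE /=.
by rewrite ![_ - _ - 1]addrAC.
Qed.

Lemma Manin_defect : (2 : F) != 0 -> is_Manin (lop_of_mx L) <->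
  forall p z, kact D (p - Ahat p) z = 0.
Proof.
move=> F2; have eqD p z : kact D (p - Ahat p) z =
    let f := lop12 (lop_of_mx L) (p - Ahat p) in
    sercoef f (down1 z) - sercoef f (down2 z) - sercoef f (swapi z)
    - (sercoef f (swap (down1 z)) - sercoef f (swap (down2 z))
       - sercoef f (swap z)).
  (* By [qR], $HR_m(w)q=H(w-1)\sigma q=(w-1)\sigma Gq$. *)
  move: (comp_Ahat_R p F2); move: (p - Ahat p) => q /= qR.
  rewrite kact_defect !sercoef_lop12 qR !kactB kact_mulu1.
  by rewrite kact_mulu2 !kact_swap.
split=> [mL p z | D0 p].
  have /(Ahat_ser_eq0 _ F2) Rq := mL p.
  by apply/eqP; rewrite eqD subr_eq0; apply/eqP; exact: Rq.
apply/(Ahat_ser_eq0 _ F2) => z; apply/eqP; rewrite -subr_eq0; apply/eqP.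
exact: etrans (esym (eqD p z)) (D0 p z).
Qed.

Lemma Manin_RLL : (2 : F) != 0 -> is_Manin (lop_of_mx L) <-> RLL L.
Proof.
move=> F2; have RLL_defect : RLL L <-> forall I K, defect I K = 0.
  split=> h I K; first by rewrite /defect h subrr.
  by apply/eqP; rewrite -subr_eq0; apply/eqP/h.
rewrite Manin_defect // RLL_defect; split=> [D0|d0 p z]; last first.
  by rewrite /kact linext.unlock big1 // => t _; rewrite /D d0 scaler0.
(* Twice $1-\widehat A_m$ sends $t$ to $t+\sigma t$ minus the divided difference of $t$. *)
have D0' t z : kact D << t >> z + kact D << swap t >> z =
    kact D (ddiff_mono t) z.
  apply/eqP; rewrite -subr_eq0 -kactD -kactB.
  have := D0 << t >> z; rewrite comp_AhatE // /ddiff linextU mapmonoU kactZ.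
  by move/eqP; rewrite scaler_eq0 invr_eq0 (negPf F2).
move=> [i j] [k l].
(* Taken from $t=e_k\otimes e_l$, whose divided difference is $0$. *)
have anti a b : defect (i, j) (l, k) (a, b) = - defect (i, j) (k, l) (a, b).
  apply/eqP; rewrite -addr_eq0 addrC; apply/eqP.
  have := D0' (Mono2 k 0 l 0) (Mono2 i a j b).
  by rewrite /= big_ord0 !kactU /= !subr0 kact0.
apply: val_inj; apply/funext => -[a b].
apply: (@laurent2_eq0 _ _ 1) => {}a {}b.
(* Taken from $t=u_1e_k\otimes e_l$, whose divided difference is $e_k\otimes e_l$; [anti] then turns
   the sum into a difference. *)
have step : defect (i, j) (k, l) (a - 1, b) + defect (i, j) (l, k) (a, b - 1)
    = defect (i, j) (k, l) (a, b).
  have := D0' (Mono2 k 1 l 0) (Mono2 i a j b).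
  by rewrite /= big_ord1 !kactU /= addr0 !subr0.
by rewrite scale1r -step anti.
Qed.

End RLLManin.

Theorem theorem4p9 (R : realType) (A : algType R[i]) (m n : nat)
    (L : 'M[laurent A]_(n, m)) :
  is_Manin (lop_of_mx L) <-> RLL L.
Proof. by apply: Manin_RLL; rewrite pnatr_eq0. Qed.
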